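(* Let $\Gamma=(x_1,\dots,x_n)$ be a finite ordered point cloud in a metric space $(X,d)$, with metric step size $S_\Gamma$ and Kuratowski embedding $\kappa(\Gamma)=(\kappa(x_1),\dots,\kappa(x_n))$. Provided $r>S_\Gamma$, we have $$\mathrm{RDC}_r(\Gamma)=\mathrm{DC}_{r/2}(\kappa(\Gamma)).$$
   Context: An ordered point cloud of length $n$ is a finite indexed family of (not necessarily distinct) points of a metric space. $B(y,r)$ denotes the open ball of radius $r$ about $y$. Metric step size: $S_\Gamma=\max_{2\le i\le n}d(x_{i-1},x_i)$ (with $S_\Gamma=0$ if $n=1$). Kuratowski embedding: for a compact metric space $(Y,d_Y)$, $L^\infty(Y)$ is the Banach space of bounded real-valued functions on $Y$ with the supremum norm, and $\kappa\colon Y\to L^\infty(Y)$, $y\mapsto d_Y(y,\cdot)$. Here it is applied to the finite metric space $Y=\{x_1,\dots,x_n\}\subset X$, so $\kappa(\Gamma)$ is an ordered point cloud in $L^\infty(Y)$. Čech complex: for an ordered point cloud $A=(a_1,\dots,a_n)$ in a metric space $Z$, $\check{\mathrm C}_r(A)$ is the simplicial complex of nonempty $\sigma\subset\{1,\dots,n\}$ with $\bigcap_{i\in\sigma}B(a_i,r)\neq\emptyset$, the balls being taken in $Z$. Elementary cubes in $\mathbb{R}^2$ are products $I_1\times I_2$ with each $I_m$ of the form $[k,k]$ or $[k,k+1]$, $k\in\mathbb{Z}$; a cubical complex is a set of elementary cubes closed under taking faces (elementary cubes contained in a member). The vertex $[i,i]\times[j,j]$ is written $(i,j)$. Distance complex: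 $\mathrm{DC}_r(A)$ is the cubical complex of all elementary cubes $[i,j]\times[k,l]\subset[1,n]^2$ (so $j\in\{i,i+1\}$, $l\in\{k,k+1\}$) with $j\le k$ and $\{i,j,k,l\}\in\check{\mathrm C}_r(A)$. Rips distance complex: $\mathrm{RDC}_r(\Gamma)$ is the full cubical subcomplex of the set of all elementary cubes in $\mathbb{R}^2$ induced by the vertex set $V_r=\{(i,j)\mid 1\le i\le j\le n,\ d(x_i,x_j)<r\}$, i.e. the set of all elementary cubes all of whose vertices lie in $V_r$. *)

(* Defs.v *)
From HB Require Import structures.
From mathcomp Require Import all_boot all_order all_algebra.
From mathcomp Require Import all_classical all_reals all_analysis.
From mathcomp Require Import lra zify.

Set Implicit Arguments.
Unset Strict Implicit.
Unset Printing Implicit Defensive.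

Import Order.TTheory GRing.Theory Num.Theory.
Import numFieldNormedType.Exports.

Local Open Scope classical_set_scope.
Local Open Scope ring_scope.

(* The library makes [set_type A] a pseudometric space whose balls are traces
   of balls of [X]; this records the restricted distance itself. *)
Section subset_metric.
Context {R : realType} {X : metricType R} (A : set X).

Let subdist (y z : A) : R := mdist (set_val y) (set_val z).

Let subdist_ge0 y z : 0 <= subdist y z.
Proof. exact: mdist_ge0. Qed.

Let subdist_positivity y z : subdist y z = 0 -> y = z.
Proof. by move/mdist_positivity; exact: val_inj. Qed.

Let ball_subdist (y : A) (e : R) : ball y e = [set z | subdist y z < e].
Proof.
rewrite -(@initial_ballE R (A : Type) X set_val) ballEmdist.
by apply/seteqP; split.
Qed.

HB.instance Definition _ := @PseudoMetric_isMetric.Build R (A : Type)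
  subdist subdist_ge0 subdist_positivity ball_subdist.

End subset_metric.

(* The bounded real-valued functions on [Y], normed by the supremum of [`|f|];
   for empty [Y] the convention [sup set0 = 0] gives the zero space. *)
Section linfty.
Context {R : realType} (Y : Type).

Definition bounded_pred : {pred Y -> R^o} :=
  fun f => `[< exists M : R, forall y, `|f y| <= M >].

Record linfty := Linfty { linfty_val :> Y -> R^o; _ : linfty_val \in bounded_pred }.

HB.instance Definition _ := [isSub for linfty_val].
HB.instance Definition _ := [Choice of linfty by <:].

Let bounded_submod : submod_closed bounded_pred.
Proof.
split.
  by apply/asboolP; exists 0 => y; rewrite normr0.
move=> a f g /asboolP[M fM] /asboolP[N gN]; apply/asboolP.
exists (`|a| * M + N) => y.
rewrite (le_trans (ler_normD _ _))// lerD//.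
by rewrite normrZ ler_wpM2l.
Qed.

HB.instance Definition _ :=
  GRing.isSubmodClosed.Build R (Y -> R^o) bounded_pred bounded_submod.
HB.instance Definition _ := [SubChoice_isSubLmodule of linfty by <:].

Definition sup_norm (f : linfty) : R := sup (range (fun y => `|f y|)).

Lemma linfty_bound (f : linfty) : exists M : R, forall y, `|f y| <= M.
Proof. by case: f => f /= /asboolP. Qed.

Lemma ler_sup_norm (f : linfty) y : `|f y| <= sup_norm f.
Proof.
have [M fM] := linfty_bound f.
apply: ub_le_sup; last by exists y.
by exists M => _ [z _ <-].
Qed.

Lemma sup_norm_ler (f : linfty) (M : R) :
  0 <= M -> (forall y, `|f y| <= M) -> sup_norm f <= M.
Proof.
move=> M0 fM; have [[y _]|/set0P/negP/negPn/eqP E] := pselect ([set: Y] !=set0).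
  by apply: ge_sup; [exists `|f y|, y|move=> _ [z _ <-]].
by rewrite /sup_norm E image_set0 sup0.
Qed.

Lemma sup_norm_ge0 (f : linfty) : 0 <= sup_norm f.
Proof.
have [[y _]|/set0P/negP/negPn/eqP E] := pselect ([set: Y] !=set0).
  exact: le_trans (ler_sup_norm f y).
by rewrite /sup_norm E image_set0 sup0.
Qed.

Let sup_normD (f g : linfty) : sup_norm (f + g) <= sup_norm f + sup_norm g.
Proof.
apply: sup_norm_ler => [|y]; first by rewrite addr_ge0// sup_norm_ge0.
by rewrite (le_trans (ler_normD _ _))// lerD// ler_sup_norm.
Qed.

Let sup_normZ_le (a : R) (f : linfty) : sup_norm (a *: f) <= `|a| * sup_norm f.
Proof.
apply: sup_norm_ler => [|y]; first by rewrite mulr_ge0// sup_norm_ge0.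
by rewrite [X in X <= _](_ : _ = `|a| * `|f y|) ?normrZ// ler_wpM2l// ler_sup_norm.
Qed.

Let sup_norm_eq0 (f : linfty) : sup_norm f = 0 -> f = 0.
Proof.
move=> f0; apply: val_inj; apply/funext => y /=.
by apply/eqP; rewrite -normr_le0 -f0 ler_sup_norm.
Qed.

Let sup_normZ (a : R) (f : linfty) : sup_norm (a *: f) = `|a| * sup_norm f.
Proof.
apply/eqP; rewrite eq_le sup_normZ_le/=.
have [->|a0] := eqVneq a 0; first by rewrite normr0 mul0r sup_norm_ge0.
rewrite -ler_pdivlMl ?normr_gt0// -normfV.
by rewrite -{1}[f]scale1r -(mulVf a0) -scalerA sup_normZ_le.
Qed.

HB.instance Definition _ := @Lmodule_isNormed.Build R linfty
  sup_norm sup_normD sup_normZ sup_norm_eq0.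

Let linfty_dist (f g : linfty) : R := `|f - g|.

Let linfty_dist_ge0 f g : 0 <= linfty_dist f g.
Proof. exact: normr_ge0. Qed.

Let linfty_dist_positivity f g : linfty_dist f g = 0 -> f = g.
Proof. by move/normr0_eq0/eqP; rewrite subr_eq0 => /eqP. Qed.

Let ball_linfty_dist (f : linfty) (e : R) :
  ball f e = [set g | linfty_dist f g < e].
Proof. by rewrite -ball_normE. Qed.

HB.instance Definition _ := @PseudoMetric_isMetric.Build R linfty
  linfty_dist linfty_dist_ge0 linfty_dist_positivity ball_linfty_dist.

End linfty.
Arguments bounded_pred : clear implicits.
Arguments linfty : clear implicits.

Section kuratowski.
Context {R : realType} {Y : metricType R}.

Lemma mdist_continuous (y : Y) : continuous (mdist y : Y -> R^o).
Proof.
move=> z; apply/cvgrPdist_lt => e e0.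
near=> t; have zt : mdist z t < e.
  by near: t; apply/nbhs_ballP; exists e => // t; rewrite ballEmdist.
rewrite (le_lt_trans _ zt)//.
have := metric_triangle y z t; have := metric_triangle y t z.
rewrite (metric_sym t z) ler_norml => h1 h2; apply/andP; split; lra.
Unshelve. all: by end_near. Qed.

Lemma mdist_bounded (y : Y) :
  compact [set: Y] -> (mdist y : Y -> R^o) \in bounded_pred R Y.
Proof.
move=> cY; apply/asboolP.
have /compact_bounded[M [_ /(_ (M + 1))]] :
    compact ((mdist y : Y -> R^o) @` [set: Y]).
  apply: continuous_compact cY; apply: continuous_subspaceT.
  exact: mdist_continuous.
rewrite ltrDl => /(_ ltr01) H; exists (M + 1) => z.
by apply: H; exists z.
Qed.

Definition kuratowski (cY : compact [set: Y]) (y : Y) : linfty R Y :=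
  Linfty (mdist_bounded y cY).

End kuratowski.

(* An ordered point cloud (x_1, ..., x_n) is a function [x : 'I_n -> X], the
   ordinal [i] standing for the index [i.+1]. *)
Section point_cloud.
Context {R : realType} {X : metricType R} {n : nat}.
Implicit Types (x : 'I_n -> X) (r : R).

Definition step_size x : R :=
  \big[Num.max/0]_(p : 'I_n * 'I_n | p.2 == p.1.+1 :> nat) mdist (x p.1) (x p.2).

Definition cloud_point x (i : 'I_n) : range x :=
  exist _ (x i) (mem_set (imageT x i)).

Lemma compact_cloud x : compact [set: range x].
Proof.
apply: finite_compact.
suff -> : [set: range x] = range (cloud_point x).
  exact: finite_image finite_finset.
apply/esym/seteqP; split=> // -[y yx] _.
have [i _ xi] := set_mem yx.
by exists i => //; apply: val_inj.
Qed.

Definition kuratowski_cloud x : 'I_n -> linfty R (range x) :=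
  fun i => kuratowski (@compact_cloud x) (cloud_point x i).

Definition cech x r : set {set 'I_n} :=
  [set s | s != finset.set0 /\ \bigcap_(i in [set` s]) ball (x i) r !=set0].

End point_cloud.

Section cubes.
Context {R : realType}.

Definition int_itv (k l : int) : set R := `[k%:~R, l%:~R].

Definition elementary_interval : set (set R) :=
  [set I | exists k : int, I = int_itv k k \/ I = int_itv k (k + 1)].

Definition elementary_cube : set (set (R * R)) :=
  [set Q | exists I J, [/\ elementary_interval I, elementary_interval J
                         & Q = I `*` J]].

Definition cubical_complex (K : set (set (R * R))) : Prop :=
  K `<=` elementary_cube /\
  forall Q Q', K Q -> elementary_cube Q' -> Q' `<=` Q -> K Q'.

Definition vertex (v : int * int) : set (R * R) :=
  int_itv v.1 v.1 `*` int_itv v.2 v.2.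

Definition full_subcomplex (V : set (int * int)) : set (set (R * R)) :=
  [set Q | elementary_cube Q /\ forall v, vertex v `<=` Q -> V v].

End cubes.

Section distance_complexes.
Context {R : realType} {X : metricType R} {n : nat}.
Implicit Types (x : 'I_n -> X) (r : R).

Definition distance_complex x r : set (set (R * R)) :=
  [set Q | exists i j k l : 'I_n,
    [/\ Q = int_itv i.+1 j.+1 `*` int_itv k.+1 l.+1,
        j = i :> nat \/ j = i.+1 :> nat,
        l = k :> nat \/ l = k.+1 :> nat,
        (j <= k)%N
      & cech x r [set i; j; k; l]%SET]].

Definition rips_vertices x r : set (int * int) :=
  [set v | exists i j : 'I_n,
    [/\ v = (i.+1 : int, j.+1 : int), (i <= j)%N & mdist (x i) (x j) < r]].

Definition rips_distance_complex x r : set (set (R * R)) :=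
  full_subcomplex (rips_vertices x r).

Lemma elementary_interval_neq0 (I : set R) : elementary_interval I -> I !=set0.
Proof.
by move=> [k [] ->]; exists k%:~R; rewrite /int_itv/= in_itv/= lexx ?ler_int//; lia.
Qed.

Lemma elementary_subinterval (I : set R) (i j : 'I_n) :
  elementary_interval I -> j = i :> nat \/ j = i.+1 :> nat ->
  I `<=` int_itv i.+1 j.+1 ->
  exists a b : 'I_n, [/\ I = int_itv a.+1 b.+1, b = a :> nat \/ b = a.+1 :> nat,
    a \in [set i; j]%SET & b \in [set i; j]%SET].
Proof.
move=> [k Ik] ij sI.
have [l [kl {Ik}IE]] : exists l, (l = k \/ l = k + 1) /\ I = int_itv k l.
  by case: Ik => ->; [exists k|exists (k + 1)]; split=> //; [left|right].
have kl' : k <= l by lia.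
rewrite {I}IE in sI *.
have : int_itv i.+1 j.+1 (k%:~R : R).
  by apply: sI; rewrite /int_itv/= in_itv/= lexx ler_int.
have : int_itv i.+1 j.+1 (l%:~R : R).
  by apply: sI; rewrite /int_itv/= in_itv/= lexx ler_int kl'.
rewrite /int_itv/= !in_itv/= !ler_int => /andP[il lj] /andP[ik kj].
have ex (m : int) : i.+1%:Z <= m -> m <= j.+1%:Z ->
    exists2 a : 'I_n, m = a.+1 & a \in [set i; j]%SET.
  move=> im mj; have [mi|mi] := eqVneq m i.+1%:Z.
    by exists i => //; rewrite !inE eqxx.
  by exists j; [lia|rewrite !inE eqxx orbT].
have [a ka aij] := ex k ik kj; have [b lb bij] := ex l il lj.
by exists a, b; split=> //; [rewrite ka lb|lia].
Qed.

Lemma distance_complex_cubical x r : cubical_complex (distance_complex x r).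
Proof.
have suc (i j : 'I_n) : j = i :> nat \/ j = i.+1 :> nat ->
    elementary_interval (int_itv i.+1 j.+1 : set R).
  by move=> [|] ->; exists i.+1; [left|right; congr int_itv; lia].
split=> [Q [i [j [k [l [-> ij kl _ _]]]]]|].
  by exists (int_itv i.+1 j.+1), (int_itv k.+1 l.+1); split=> //; exact: suc.
move=> Q Q' [i [j [k [l [-> ij kl jk sr]]]]] [I [J [eI eJ ->]]] IJ.
have I0 := elementary_interval_neq0 eI; have J0 := elementary_interval_neq0 eJ.
have sI : I `<=` int_itv i.+1 j.+1.
  by have [v Jv] := J0 => u Iu; have [] := IJ (u, v) (conj Iu Jv).
have sJ : J `<=` int_itv k.+1 l.+1.
  by have [u Iu] := I0 => v Jv; have [] := IJ (u, v) (conj Iu Jv).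
have [a [b [-> ab ai bi]]] := elementary_subinterval eI ij sI.
have [c [d [-> cd ck dk]]] := elementary_subinterval eJ kl sJ.
exists a, b, c, d; split=> //.
  have bj : (b <= j)%N by case/set2P: bi => ->; lia.
  have kc : (k <= c)%N by case/set2P: ck => ->; lia.
  lia.
case: sr => _ [z zr]; split; first by apply/set0Pn; exists a; rewrite !inE eqxx.
exists z => m /= mabcd; apply: zr => /=.
move: ai bi ck dk mabcd; rewrite !inE.
by do 4![case/orP=> /eqP->]; rewrite -!orbA => /or4P[] ->; rewrite ?orbT.
Qed.

Lemma rips_distance_complex_cubical x r :
  cubical_complex (rips_distance_complex x r).
Proof.
split=> [Q []//|Q Q' [_ QV] cQ' Q'Q]; split=> // v vQ'.
by apply: QV; exact: subset_trans Q'Q.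
Qed.

End distance_complexes.

(* Main.v *)
Require Import Defs.
From mathcomp Require Import all_boot all_order all_algebra.
From mathcomp Require Import all_classical all_reals all_analysis.
From mathcomp Require Import lra zify.

(** Both complexes consist of squares [i, j] x [k, l] with j in {i, i + 1},
    l in {k, k + 1} and j <= k, and they differ only in the smallness condition
    on the four points involved: the Rips complex bounds the four distances
    between a point of {x_i, x_j} and one of {x_k, x_l}, the Cech complex asks
    that four balls of radius [r / 2] in the space of bounded functions have a
    common point.

    Balls in a space of bounded functions have a Helly property: finitely many
    balls of radius [r / 2] meet as soon as their centers are pairwise at
    distance less than [r]. Hence the Cech condition says exactly that all
    pairwise distances are less than [r] ([cech_linfty]), and as the Kuratowski
    embedding is an isometry ([kuratowski_isometry]) these are the distances in
    the original space. The only pairs that the vertices of a square do not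
    control are (i, j) and (k, l); they are consecutive or equal, so their
    distances are at most the step size, which is less than [r]. *)

Set Implicit Arguments.
Unset Strict Implicit.
Unset Printing Implicit Defensive.

Import Order.TTheory GRing.Theory Num.Theory.
Import numFieldNormedType.Exports.

Local Open Scope classical_set_scope.
Local Open Scope ring_scope.

(** The center is the pointwise maximum of the [a i], lowered by [D / 2]: at
    each point the values [a i y] fill an interval of length at most [D], and
    lowering its upper end by [D / 2] gives a number within [D / 2] of them all. *)
Lemma linfty_common_center (R : realType) (Y : Type) (I : finType)
    (a : I -> linfty R Y) (s : {set I}) (D : R) : s != finset.set0 -> 0 <= D ->
    {in s &, forall i j, `|a i - a j| <= D} ->
  exists f : linfty R Y, {in s, forall i, `|a i - f| <= D / 2}.
Proof.
move=> /set0Pn[i0 i0s] D0 aD.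
have aDy i j y : i \in s -> j \in s -> a i y - a j y <= D.
  move=> si sj; apply: le_trans (aD i j si sj).
  exact: le_trans (ler_norm _) (ler_sup_norm (a i - a j) y).
pose M y : R := \big[Num.max/a i0 y]_(i in s) a i y.
have aM i y : i \in s -> a i y <= M y by move=> si; exact: le_bigmax_cond.
have MD i y : i \in s -> M y <= a i y + D.
  move=> si; apply: bigmax_le => [|j sj].
    by have := aDy i0 i y i0s si; lra.
  by have := aDy j i y sj si; lra.
have near_f i y : i \in s -> `|a i y - (M y - D / 2)| <= D / 2.
  move=> si; have := aM i y si; have := MD i y si.
  by rewrite ler_norml => ? ?; apply/andP; split; lra.
have bf : (fun y => M y - D / 2 : R^o) \in bounded_pred R Y.
  apply/asboolP; have [B aB] := linfty_bound (a i0); exists (B + D / 2) => y.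
  have := near_f i0 y i0s; have := aB y.
  by rewrite !ler_norml => /andP[? ?] /andP[? ?]; apply/andP; split; lra.
exists (Linfty bf) => i si; apply: sup_norm_ler => [|y]; first by lra.
exact: near_f.
Qed.

(** The Helly property of balls in spaces of bounded functions: a common point
    of the balls of radius [r / 2] bounds the distances by the triangle
    inequality, and conversely the center of the family lies in all the balls. *)
Lemma cech_linfty (R : realType) (Y : Type) (n : nat)
    (a : 'I_n -> linfty R Y) (r : R) (s : {set 'I_n}) :
  cech a (r / 2) s <->
  s != finset.set0 /\ {in s &, forall i j, `|a i - a j| < r}.
Proof.
split=> [[s0 [f fa]]|[s0 ar]]; split=> //.
  move=> i j si sj; have := fa i si; have := fa j sj.
  rewrite -!ball_normE /= => ajf aif.
  have := ler_distD f (a i) (a j); rewrite (distrC f); lra.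
(* The common center needs a non-strict bound below [r]: the diameter of the
   finite family. *)
pose D : R := \big[Num.max/0]_(p : 'I_n * 'I_n | (p.1 \in s) && (p.2 \in s))
  `|a p.1 - a p.2|.
have Dr : D < r.
  have /set0Pn[i si] := s0.
  apply: bigmax_lt => [|p /andP[]]; last exact: ar.
  by have := ar i i si si; rewrite subrr normr0.
have D0 : 0 <= D by exact: bigmax_ge_id.
have [|f fa] := linfty_common_center (a := a) s0 D0.
  move=> i j si sj.
  apply: (le_bigmax_cond (j := (i, j)) _ (fun p => `|a p.1 - a p.2|)) => /=.
  by rewrite si sj.
exists f => i si; rewrite -ball_normE /=.
by apply: le_lt_trans (fa i si) _; lra.
Qed.

(** The triangle inequality bounds [|d(y, t) - d(z, t)|] by [d(y, z)], and
    [t = z] attains the bound. *)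
Lemma kuratowski_isometry (R : realType) (Y : metricType R)
    (cY : compact [set: Y]) (y z : Y) :
  `|kuratowski cY y - kuratowski cY z| = mdist y z.
Proof.
apply/eqP; rewrite eq_le; apply/andP; split.
  apply: sup_norm_ler => [|t]; first exact: mdist_ge0.
  rewrite [X in `|X|](_ : _ = mdist y t - mdist z t)//.
  have := metric_triangle y z t; have := metric_triangle z y t.
  by rewrite (metric_sym z y) ler_norml => ? ?; apply/andP; split; lra.
have yz : mdist y z = (kuratowski cY y - kuratowski cY z) z.
  by rewrite [RHS](_ : _ = mdist y z - mdist z z)// mdistxx subr0.
rewrite {1}yz; exact: le_trans (ler_norm _) (ler_sup_norm _ z).
Qed.

Lemma cech_kuratowski (R : realType) (X : metricType R) (n : nat)
    (x : 'I_n -> X) (r : R) (s : {set 'I_n}) :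
  cech (kuratowski_cloud x) (r / 2) s <->
  s != finset.set0 /\ {in s &, forall i j, mdist (x i) (x j) < r}.
Proof.
have iso i j : `|kuratowski_cloud x i - kuratowski_cloud x j|
             = mdist (x i) (x j) by exact: kuratowski_isometry.
split=> [/cech_linfty[s0 xr]|[s0 xr]]; last apply/cech_linfty; split=> //.
  by move=> i j si sj; rewrite -iso; exact: xr.
by move=> i j si sj; rewrite iso; exact: xr.
Qed.

Lemma elementary_intervalP (R : realType) (I : set R) :
  elementary_interval I ->
  exists p q : int, [/\ I = int_itv p q, p <= q & q <= p + 1].
Proof.
by move=> [k [] ->]; [exists k, k|exists k, (k + 1)]; split=> //; lia.
Qed.

Lemma vertex_subset (R : realType) (v : int * int) (p q p' q' : int) :
  (vertex v : set (R * R)) `<=` int_itv p q `*` int_itv p' q' <->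
  (p <= v.1 <= q) /\ (p' <= v.2 <= q').
Proof.
rewrite /vertex /int_itv; split=> [/(_ (v.1%:~R, v.2%:~R))|].
  by rewrite /= !in_itv /= !lexx !ler_int; apply.
move=> [/andP[pv vq] /andP[pv' vq']] [u w] /=; rewrite !in_itv /=.
move=> [/andP[vu uv] /andP[vw wv]]; split; apply/andP; split.
- by apply: le_trans vu; rewrite ler_int.
- by apply: le_trans uv _; rewrite ler_int.
- by apply: le_trans vw; rewrite ler_int.
- by apply: le_trans wv _; rewrite ler_int.
Qed.

Lemma mdist_le_step_size (R : realType) (X : metricType R) (n : nat)
    (x : 'I_n -> X) (i j : 'I_n) :
  j = i :> nat \/ j = i.+1 :> nat -> mdist (x i) (x j) <= step_size x.
Proof.
move=> [/val_inj ->|ij]; first by rewrite mdistxx; exact: bigmax_ge_id.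
apply: (le_bigmax_cond (j := (i, j)) _ (fun p => mdist (x p.1) (x p.2))).
exact/eqP.
Qed.

Theorem proposition4p17 (R : realType) (X : metricType R) (n : nat)
    (x : 'I_n -> X) (r : R) (hr : step_size x < r) :
  rips_distance_complex x r = distance_complex (kuratowski_cloud x) (r / 2).
Proof.
have step (i j : 'I_n) : j = i :> nat \/ j = i.+1 :> nat -> mdist (x i) (x j) < r.
  by move=> ij; exact: le_lt_trans (mdist_le_step_size x ij) hr.
apply/seteqP; split=> Q.
  (* The vertex (q, p'), that is (j, k), lies on or above the diagonal, which
     is the condition j <= k of the distance complex. *)
  move=> [[_ [_ [/elementary_intervalP[p [q [-> pq qp]]]
                 /elementary_intervalP[p' [q' [-> pq' qp']]] ->]]] QV].
  have V u v : p <= u <= q -> p' <= v <= q' -> rips_vertices x r (u, v).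
    by move=> pu pv; apply: QV; apply/vertex_subset.
  have [||i [k [[pE pE'] ik dik]]] := V p p'; [lia|lia|].
  have [||j [l [[qE qE'] jl djl]]] := V q q'; [lia|lia|].
  have [||i' [l' [[iE lE] il dil]]] := V p q'; [lia|lia|].
  have [||j' [k' [[jE kE] jk djk]]] := V q p'; [lia|lia|].
  have ? : i' = i by apply: val_inj => /=; lia.
  have ? : l' = l by apply: val_inj => /=; lia.
  have ? : j' = j by apply: val_inj => /=; lia.
  have ? : k' = k by apply: val_inj => /=; lia.
  subst.
  have ij : j = i :> nat \/ j = i.+1 :> nat by lia.
  have kl : l = k :> nat \/ l = k.+1 :> nat by lia.
  exists i, j, k, l; split=> //; apply/cech_kuratowski; split.
    by apply/set0Pn; exists i; rewrite !inE eqxx.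
  have xx m : mdist (x m) (x m) < r by apply: step; left.
  have dij := step _ _ ij; have dkl := step _ _ kl.
  by move=> a b; rewrite !inE -!orbA => /or4P[] /eqP-> /or4P[] /eqP->;
    rewrite // metric_sym.
move=> DQ; split; first exact: (distance_complex_cubical _ _).1 DQ.
move: DQ => [i [j [k [l [-> ij kl jk /cech_kuratowski[_ xr]]]]]] [u v].
move=> /vertex_subset[/= /andP[iu uj] /andP[kv vl]].
have [a ua aij] : exists2 a : 'I_n, u = a.+1 & (a == i) || (a == j).
  have [ui|ui] := eqVneq u i.+1%:Z; first by exists i; rewrite ?eqxx.
  by exists j; [lia|rewrite eqxx orbT].
have [b vb bkl] : exists2 b : 'I_n, v = b.+1 & (b == k) || (b == l).
  have [vk|vk] := eqVneq v k.+1%:Z; first by exists k; rewrite ?eqxx.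
  by exists l; [lia|rewrite eqxx orbT].
exists a, b; split; first by rewrite ua vb.
  by case/orP: aij => /eqP->; case/orP: bkl => /eqP->; lia.
by apply: xr; rewrite !inE -!orbA ?orbA ?aij // -orbA bkl orbT.
Qed.
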